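(* For every prime $p$ and every integer $k \geq 1$ there is an integer $N$ such that, if $M$ is a simple $\mathrm{GF}(p)$-representable matroid with rank at least $N$ and girth at least five, then $M$ contains a rank-$k$ independent flat (that is, a flat of rank $k$ that is an independent set of $M$).
   Context: Matroids are finite. $\mathrm{GF}(p)$ is the field with $p$ elements. The girth of a matroid is the minimum size of a circuit, taken to be $\infty$ if there are no circuits. *)

(* Defs.v *)
From mathcomp Require Import all_boot all_order all_algebra.

Set Implicit Arguments.
Unset Strict Implicit.
Unset Printing Implicit Defensive.

(* The ground set of a matroid is the whole finite type [T]. *)
Record matroid (T : finType) := Matroid {
  indep : pred {set T};
  indep_set0 : indep set0;
  indep_subset : forall I J : {set T}, I \subset J -> indep J -> indep I;
  indep_augment : forall I J : {set T}, indep I -> indep J -> #|I| < #|J| ->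
    exists2 x, x \in J :\: I & indep (x |: I)
}.

Section MatroidNotions.

Variables (T : finType) (M : matroid T).

Definition rank_of (X : {set T}) : nat :=
  \max_(I : {set T} | (I \subset X) && indep M I) #|I|.

Definition matroid_rank : nat := rank_of [set: T].

Definition circuit (C : {set T}) : bool := minset (fun X => ~~ indep M X) C.

Definition loop (x : T) : bool := circuit [set x].

Definition parallel (x y : T) : bool := (x != y) && circuit [set x; y].

Definition simple_matroid : Prop :=
  (forall x, ~~ loop x) /\ (forall x y, ~~ parallel x y).

(* [None] stands for infinity. *)
Definition girth : option nat :=
  if [pick C | circuit C] is Some C0
  then Some #|[arg min_(C < C0 | circuit C) #|C| ]|
  else None.

Definition closure_of (X : {set T}) : {set T} :=
  [set x | rank_of (x |: X) == rank_of X].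

Definition flat (X : {set T}) : bool := closure_of X == X.

(* [free] applies to the family (v x) for x in X, not to its set of values:
   a repeated vector makes the family dependent. *)
Definition representable (F : fieldType) : Prop :=
  exists (m : nat) (v : T -> 'cV[F]_m),
    forall X : {set T}, indep M X = free [seq v x | x in X].

End MatroidNotions.

(* The order of the naturals extended by infinity. *)
Definition leq_inf (n : nat) (g : option nat) : bool :=
  if g is Some m then n <= m else true.

(* Main.v *)
(* Build the flat greedily, maintaining an independent X such that e |: X is
   independent for every e outside X.  An element d cannot be added to X when
   some other e makes {d, e} dependent over X, that is, when v d - b v e lies in
   the span of X for some scalar b.  If d and d' give the same vector of that
   span, with witnesses e and e', then v d' lies in the span of v d, v e, v e',
   and as there is no circuit of size at most four, d' is d or e.  Hence each
   vector of the span excludes at most two elements, so over a field with q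
   elements at most 2 q^|X| elements are excluded. *)
Require Import Defs.
From mathcomp Require Import all_boot all_order all_algebra all_field.

Set Implicit Arguments.
Unset Strict Implicit.
Unset Printing Implicit Defensive.

Import GRing.Theory.

Section MatroidFacts.

Variables (T : finType) (M : matroid T).

Lemma rank_of_indep (X : {set T}) : indep M X -> rank_of M X = #|X|.
Proof.
move=> iX; apply/eqP; rewrite eqn_leq /rank_of; apply/andP; split.
  by apply/bigmax_leqP => I /andP[sIX _]; exact: subset_leq_card.
by rewrite (bigD1 X) ?subxx //= leq_maxl.
Qed.

Lemma matroid_rank_le_card : matroid_rank M <= #|T|.
Proof. by apply/bigmax_leqP => I _; exact: max_card. Qed.

(** Both ranks are cardinalities here, so adding an element outside [X] raises the rank by one and
    [X] is its own closure. *)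
Lemma flat_indep (X : {set T}) :
  indep M X -> (forall e, e \notin X -> indep M (e |: X)) -> flat M X.
Proof.
move=> iX iXe; rewrite /flat; apply/eqP/setP => e; rewrite inE.
case: (boolP (e \in X)) => eX; first by rewrite (setUidPr _) ?sub1set ?eqxx.
by rewrite !rank_of_indep ?iXe // cardsU1 eX -[X in _ == X]add0n eqn_add2r.
Qed.

Lemma indep_small (g : nat) (X : {set T}) :
  leq_inf g.+1 (girth M) -> #|X| <= g -> indep M X.
Proof.
move=> gM leX; apply/negPn/negP => nX.
have [C cC sCX] := minset_exists (P := fun X => ~~ indep M X) nX.
move: gM; rewrite /girth; case: pickP => [C0 cC0|/(_ C)]; last first.
  by rewrite /circuit cC.
case: arg_minnP => // C1 _ /(_ C cC) leC1 /=.
by rewrite ltnNge (leq_trans leC1) // (leq_trans (subset_leq_card sCX)).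
Qed.

End MatroidFacts.

Lemma card_le_fibers (F : finFieldType) (vT : vectType F) (T : finType)
    (A : {set T}) (f : T -> vT) (V : {vspace vT}) (c : nat) :
  (forall x, x \in A -> f x \in V) ->
  (forall x, x \in A -> #|[set y in A | f y == f x]| <= c) ->
  #|A| <= c * #|F| ^ \dim V.
Proof.
(* [finvect_type] views the same space as a finite type, so the vectors of [V] can be counted and
   can index the fibers of [f]. *)
case: vT f V => S cS f V fV fib; pose vT := Vector.Pack cS.
pose W : {vspace finvect_type vT} := V.
rewrite -[_ ^ _](card_vspace W) mulnC -sum_nat_const -sum1_card.
rewrite (partition_big (f : T -> finvect_type vT) (mem W)) //=.
apply: leq_sum => w _; rewrite sum1dep_card.
have [-> | [x]] := set_0Vmem [set y in A | (f y : finvect_type vT) == w].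
  by rewrite cards0.
by rewrite inE => /andP[xA /eqP <-]; exact: fib.
Qed.

Section Representation.

Variables (F : finFieldType) (vT : vectType F) (T : finType) (M : matroid T).
Variable v : T -> vT.
Hypothesis vM : forall X : {set T}, indep M X = free [seq v x | x in X].

Local Notation spanv X := <<[seq v x | x in X]>>%VS.

Lemma perm_image_setU1 (x : T) (X : {set T}) : x \notin X ->
  perm_eq [seq v y | y in x |: X] (v x :: [seq v y | y in X]).
Proof.
move=> xX; rewrite /image_mem -map_cons; apply: perm_map.
apply: uniq_perm; rewrite /= ?mem_enum ?xX ?enum_uniq //.
by move=> y; rewrite inE !mem_enum !inE.
Qed.

Lemma indepU1 (x : T) (X : {set T}) : x \notin X ->
  indep M (x |: X) = (v x \notin spanv X) && indep M X.
Proof.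
by move=> xX; rewrite !vM (perm_free (perm_image_setU1 xX)) free_cons.
Qed.

Lemma spanU1 (x : T) (X : {set T}) : x \notin X ->
  spanv (x |: X) = (<[v x]> + spanv X)%VS.
Proof.
move=> xX; rewrite -span_cons; apply: eq_span.
exact: perm_mem (perm_image_setU1 xX).
Qed.

Hypothesis gM : leq_inf 5 (girth M).

Section Extension.

Variable X : {set T}.
Hypothesis iX : forall e, e \notin X -> indep M (e |: X).

Definition obstructed : {set T} :=
  [set d | (d \notin X) &&
    [exists e, (e \notin d |: X) && ~~ indep M (e |: (d |: X))]].

Lemma obstructedP (d : T) : d \in obstructed ->
  exists w, w \in spanv X /\
    exists e b, d != e /\ v d = (b *: v e + w)%R.
Proof.
rewrite inE => /andP[dX /existsP[e /andP[]]].
rewrite !inE negb_or => /andP[ned eX].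
have deX : d \notin e |: X by rewrite !inE negb_or eq_sym ned.
(* Exchange [d] and [e]: since [e |: X] is independent, the dependence puts [v d] in the span of
   [e |: X]. *)
rewrite setUCA (indepU1 deX) iX // andbT negbK spanU1 //.
case/memv_addP => _ /vlineP[b ->] [w wX vd].
by exists w; split=> //; exists e, b; rewrite eq_sym.
Qed.

Lemma same_offset (d e d' e' : T) (b b' : F) (w : vT) : d' != e' ->
  v d = (b *: v e + w)%R -> v d' = (b' *: v e' + w)%R -> d' \in [set d; e].
Proof.
move=> ne' vd vd'; apply/negPn/negP => nd'.
have: indep M (d' |: [set d; e; e']).
  (* The size is at most 1 + 1 + 2 = 4; coincidences among [d], [e], [e'] only lower it. *)
  apply: (indep_small gM); rewrite cardsU1 -add1n leq_add ?leq_b1 //.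
  rewrite setUC cardsU1 -add1n leq_add ?leq_b1 //.
  by rewrite cards2; case: (_ != _).
rewrite indepU1; last by rewrite in_setU negb_or nd' inE.
case/andP => /negP vd'S _; apply: vd'S.
have mem x : x \in [set d; e; e'] -> v x \in spanv [set d; e; e'].
  by move=> xS; apply: memv_span; apply: image_f.
(* Eliminating the common offset [w] leaves a combination of at most three other vectors. *)
have -> : v d' = (b' *: v e' + (v d - b *: v e))%R.
  by rewrite vd addrAC subrr add0r.
by rewrite rpredD ?rpredB ?rpredZ ?mem ?inE ?eqxx ?orbT.
Qed.

Lemma card_obstructed : #|obstructed| <= 2 * #|F| ^ #|X|.
Proof.
(* Choose one offset for each obstructed [d]; elsewhere the value 0 is arbitrary, as fibers are
   counted inside [obstructed]. *)
have /fin_all_exists[f fP] (d : T) : exists w, d \in obstructed ->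
    w \in spanv X /\ exists e b, d != e /\ v d = (b *: v e + w)%R.
  case: (boolP (d \in obstructed)) => [/obstructedP[w]|_]; last by exists 0%R.
  by exists w.
have: #|obstructed| <= 2 * #|F| ^ \dim (spanv X).
  apply: (card_le_fibers (f := f)) => [d /fP[]//|d /fP[_ [e [b [_ vd]]]]].
  apply: (@leq_trans #|[set d; e]|); last by rewrite cards2; case: (_ != _).
  apply/subset_leq_card/subsetP => d'; rewrite inE => /andP[/fP[_ ] ].
  case=> e' [b' [ne' vd']] /eqP fd; rewrite fd in vd'.
  exact: same_offset ne' vd vd'.
move=> /leq_trans; apply; rewrite leq_mul2l leq_pexp2l ?orbT //.
  by apply/card_gt0P; exists 0%R.
by apply: leq_trans (dim_span _) _; rewrite size_image.
Qed.

Lemma extend : #|X| + 2 * #|F| ^ #|X| < #|T| ->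
  exists2 d, d \notin X &
    forall e, e \notin d |: X -> indep M (e |: (d |: X)).
Proof.
move=> ltT; have [d] : exists d, d \notin X :|: obstructed.
  apply/existsP; rewrite -negb_forall; apply/negP => /forallP allT.
  have : #|T| <= #|X :|: obstructed|.
    by rewrite -cardsT; apply/subset_leq_card/subsetP => d _; exact: allT.
  rewrite leqNgt (leq_ltn_trans _ ltT) //.
  by rewrite (leq_trans (leq_card_setU _ _)) // leq_add2l card_obstructed.
rewrite !inE negb_or => /andP[dX]; rewrite dX /= => /existsPn dP.
by exists d => // e edX; have := dP e; rewrite edX negbK.
Qed.

End Extension.

(** The condition on all [e] outside [X] drives the induction: it makes the next set independent,
    and it makes the final [X] a flat. *)
Lemma indep_flat_of_card (k : nat) : k + 2 * #|F| ^ k < #|T| ->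
  exists X : {set T}, [/\ #|X| = k, indep M X &
    forall e, e \notin X -> indep M (e |: X)].
Proof.
elim: k => [_|k IHk ltT].
  exists set0; split; rewrite ?cards0 ?indep_set0 // => e _.
  (* The girth bound excludes loops, so singletons are independent. *)
  by rewrite setU0 (indep_small gM) ?cards1.
have F0 : 0 < #|F| by apply/card_gt0P; exists 0%R.
have ltT' : k + 2 * #|F| ^ k < #|T|.
  by apply: leq_ltn_trans ltT; rewrite leq_add ?leq_mul ?leq_pexp2l.
have [X [cX _ iX]] := IHk ltT'.
have [|d dX iXd] := extend iX; first by rewrite cX.
by exists (d |: X); split; rewrite ?cardsU1 ?dX ?cX //; exact: iX.
Qed.

End Representation.

Theorem corollary1p3 (p : nat) (hp : prime p) (k : nat) (hk : 1 <= k) :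
  exists N : nat, forall (T : finType) (M : matroid T),
    simple_matroid M -> representable M 'F_p ->
    N <= matroid_rank M -> leq_inf 5 (girth M) ->
    exists X : {set T}, [/\ flat M X, rank_of M X = k & indep M X].
Proof.
(* The rank is at most #|T|, so this bound forces a large ground set; the successor gives the strict
   inequality. *)
exists (k + 2 * p ^ k).+1 => T M _ [m [v vM]] leN gM.
have ltT : k + 2 * #|'F_p| ^ k < #|T|.
  by rewrite card_Fp //; exact: leq_trans leN (matroid_rank_le_card M).
have [X [cX iX iXe]] := indep_flat_of_card vM gM ltT.
by exists X; split; rewrite ?rank_of_indep //; exact: flat_indep.
Qed.
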